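(* Let $m \in \mathbb{N}$, let $r := 4m+2$ and let $n \in \mathbb{N}$ be divisible by $2r(r+1)$. Let $G$ be the complete balanced $(r+1)$-partite graph on $n$ vertices (and so $\delta(G) = (1 - 1/(r+1))n$). Then there is a function $f : E(G) \to \{-1, 1\}$ such that every perfect $K_r$-tiling $\mathcal{T}$ in $G$ satisfies $$\sum_{e \in E(\mathcal{T})} f(e) = 0.$$
   Context: $\mathbb{N}$ denotes the positive integers. All graphs are finite and simple. The complete balanced $(r+1)$-partite graph on $n$ vertices (with $r+1$ dividing $n$) has its vertex set partitioned into $r+1$ classes of size $n/(r+1)$ each, with two vertices adjacent if and only if they lie in different classes. $E(G)$ is the edge set and $\delta(G)$ the minimum degree of $G$; $K_r$ is the complete graph on $r$ vertices. A perfect $K_r$-tiling in a graph $G$ is a collection $\mathcal{T}$ of vertex-disjoint copies of $K_r$ contained in $G$ (as subgraphs) that together cover every vertex of $G$. $E(\mathcal{T})$ denotes the set of all edges of $G$ lying in one of the copies of $K_r$ in $\mathcal{T}$. *)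

(* Defs.v *)
From mathcomp Require Import all_boot all_order all_algebra.

Set Implicit Arguments.
Unset Strict Implicit.
Unset Printing Implicit Defensive.

Record sgraph := SGraph {
  vertex :> finType;
  adj : rel vertex;
  adj_sym : symmetric adj;
  adj_irrefl : irreflexive adj }.

Definition edges (G : sgraph) : {set {set G}} :=
  [set [set p.1; p.2] | p : G * G & adj p.1 p.2].

Definition degree (G : sgraph) (x : G) : nat := #|[set y | adj x y]|.

(* Every degree is at most #|G|, so for a nonempty graph the default value
   does not affect the minimum. *)
Definition min_degree (G : sgraph) : nat :=
  \big[minn/#|G|]_(x : G) degree x.

Definition complete_balanced_partite (k : nat) (G : sgraph) : Prop :=
  exists P : {set {set G}},
    [/\ partition P [set: G],
        #|P| = k,
        forall A : {set G}, A \in P -> #|A| = #|G| %/ k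
      & forall x y : G, adj x y = (pblock P x != pblock P y)].

(* A copy of the complete graph on r vertices, as a subgraph of G, has all
   pairs of its vertices as edges, hence is given by its vertex set. *)
Definition clique_copy (r : nat) (G : sgraph) (A : {set G}) : Prop :=
  #|A| = r /\ {in A &, forall x y : G, x != y -> adj x y}.

Definition perfect_clique_tiling (r : nat) (G : sgraph)
    (T : {set {set G}}) : Prop :=
  [/\ forall A : {set G}, A \in T -> clique_copy r A, trivIset T & cover T = [set: G]].

Definition tiling_edges (G : sgraph) (T : {set {set G}}) : {set {set G}} :=
  [set e in edges G | [exists A in T, e \subset A]].

(* Main.v *)
Require Import Defs.
From mathcomp Require Import all_boot all_order all_algebra.
From mathcomp Require Import zify ring.

Set Implicit Arguments.
Unset Strict Implicit.
Unset Printing Implicit Defensive.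

(** Write [r = 4m+2] and let the classes have size [2rk], so that a perfect
    tiling [T] has [2k(r+1)] copies and [2k(r+1) * 'C(r, 2)] edges.  A copy
    meets every class but one, in a single vertex, and this makes two statistics
    the same for all tilings:
    - a vertex is in one copy, so a set [A] of vertices of a single class is met
      by [#|A| * (r-1)] tiling edges ([card_pairs_meeting]);
    - a class is met by as many copies as it has vertices, and two classes
      cannot be missed by the same copy, so inclusion-exclusion gives
      [2 * 2rk - 2k(r+1) = 2k(r-1)] copies meeting both classes of a given pair
      ([card_hit_pair]).
    Labels depending only on the classes of the endpoints cannot suffice, as
    there are oddly many pairs of classes.  One class [V] is therefore set
    apart.  Among the [r] other classes, label positively all edges between the
    pairs in a set [C] of [('C(r, 2) + 1) / 2] pairs, which is an integer because
    ['C(r, 2) = (2m+1)(4m+1)] is odd.  The excess of one pair is compensated at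
    [V]: an edge at [V] is positive when its end in [V] lies in a fixed set [A]
    of [(r-1)k] vertices, slightly less than half of [V].  The number of positive
    tiling edges is then
    [(r-1)k * (r-1) + ('C(r, 2) + 1) / 2 * 2k(r-1) = k(r+1) * 'C(r, 2)],
    half of all tiling edges. *)

(** * Two-element subsets *)

Definition pairs_in (X : finType) (B : {set X}) : {set {set X}} :=
  [set e : {set X} | (e \subset B) && (#|e| == 2)].

Lemma card_pairs_in (X : finType) (B : {set X}) :
  #|pairs_in B| = 'C(#|B|, 2).
Proof. exact: cards_draws. Qed.

Lemma card_setId_sum (X : finType) (E : {set X}) (p : pred X) :
  #|[set e in E | p e]| = \sum_(e in E) p e.
Proof.
rewrite -sum1_card (eq_bigl (fun e => (e \in E) && p e)) => [|e].
  by rewrite big_mkcondr; apply: eq_bigr => e _; case: (p e).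
by rewrite inE.
Qed.

Lemma exists_subset_card (X : finType) (B : {set X}) k :
  k <= #|B| -> exists2 A : {set X}, A \subset B & #|A| = k.
Proof.
rewrite -bin_gt0 -cards_draws => /card_gt0P[A].
by rewrite inE => /andP[AB /eqP cA]; exists A.
Qed.

(** The pairs avoiding [A] are those of [B :\: A], so the count is
    ['C(#|B|, 2) - 'C(#|B| - a, 2)] where [a = #|A :&: B|] is 0 or 1. *)
Lemma card_pairs_meeting (X : finType) (A B : {set X}) :
  #|A :&: B| <= 1 ->
  #|[set e in pairs_in B | e :&: A != set0]| = #|A :&: B| * #|B|.-1.
Proof.
move=> a_le1.
have split := cardsID [set e : {set X} | e :&: A != set0] (pairs_in B).
have avoidE : pairs_in B :\: [set e : {set X} | e :&: A != set0] = pairs_in (B :\: A).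
  apply/setP=> e; rewrite !inE negbK subsetD setI_eq0.
  by rewrite andbCA andbA.
rewrite avoidE !card_pairs_in -setIdE in split.
have cD := cardsID A B; rewrite setIC in cD.
apply/eqP; rewrite -(eqn_add2r 'C(#|B :\: A|, 2)) split; apply/eqP.
case: #|A :&: B| a_le1 cD => [|[|//]] _ <-; first by rewrite mul0n.
by rewrite !add1n binS bin1 mul1n addnC.
Qed.

(** [e |-> h @: e] is a bijection between the two sets, with inverse
    [c |-> B :&: h @^-1: c]. *)
Lemma card_pairs_image (X Y : finType) (h : X -> Y) (B : {set X})
    (C : {set {set Y}}) :
  {in B &, injective h} -> (forall c, c \in C -> #|c| = 2) ->
  #|[set e in pairs_in B | h @: e \in C]| = #|[set c in C | c \subset h @: B]|.
Proof.
move=> h_inj C2.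
have sub_img (c : {set Y}) : c \subset h @: B -> h @: (B :&: h @^-1: c) = c.
  move=> cB; apply/setP=> y; apply/imsetP/idP => [[x]|yc].
    by rewrite !inE => /andP[_ ?] ->.
  have /imsetP[x xB yE] := subsetP cB y yc.
  by exists x => //; rewrite !inE xB -yE.
have sub_preimg (e : {set X}) : e \subset B -> B :&: h @^-1: (h @: e) = e.
  move=> eB; apply/setP=> x; rewrite !inE; apply/andP/idP => [[xB]|xe].
    by case/imsetP=> y ye /h_inj -> //; apply: (subsetP eB).
  by split; [apply: (subsetP eB) | apply: imset_f].
rewrite -(@card_in_imset _ _ (fun e : {set X} => h @: e)); last first.
  move=> e1 e2; rewrite !inE => /andP[/andP[e1B _] _] /andP[/andP[e2B _] _] eqh.
  by rewrite -(sub_preimg _ e1B) -(sub_preimg _ e2B) eqh.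
apply: eq_card => c; apply/imsetP/idP => [[e]|].
  by rewrite !inE => /andP[/andP[eB _] eC] ->; rewrite eC imsetS.
rewrite inE => /andP[cC cB]; exists (B :&: h @^-1: c); last by rewrite sub_img.
rewrite !inE sub_img // cC subsetIl andbT /=.
rewrite -(card_in_imset (f := h)) ?sub_img ?C2 //.
by move=> x y /setIP[xB _] /setIP[yB _]; apply: h_inj.
Qed.

(** * Perfect tilings *)

Lemma sum_cardI_tiling (X : finType) (T : {set {set X}}) (A : {set X}) :
  trivIset T -> cover T = [set: X] -> \sum_(B in T) #|A :&: B| = #|A|.
Proof.
move=> triv cov; rewrite -sum1_card.
transitivity (\sum_(x in cover T | x \in A) 1).
  rewrite big_trivIset_cond //; apply: eq_bigr => B _; rewrite -sum1_card.
  by apply: eq_bigl => x; rewrite inE andbC.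
by apply: eq_bigl => x; rewrite cov inE.
Qed.

(** Copies are disjoint cliques, so a tiling edge is the same thing as a pair
    inside one copy, and that copy is unique. *)
Lemma sum_tiling_edges (r : nat) (G : sgraph) (T : {set {set G}})
    (w : {set G} -> nat) :
  perfect_clique_tiling r T ->
  \sum_(e in tiling_edges T) w e = \sum_(B in T) \sum_(e in pairs_in B) w e.
Proof.
move=> [cliqueT triv _].
have pairE (B e : {set G}) : B \in T -> e \in pairs_in B ->
    e \in tiling_edges T.
  move=> BT; rewrite !inE => /andP[eB /cards2P[x [y [xy eE]]]].
  apply/andP; split; last by apply/existsP; exists B; rewrite BT eB.
  apply/imsetP; exists (x, y) => //; rewrite inE /=.
  by apply: (cliqueT B BT).2 => //; apply: (subsetP eB); rewrite eE !inE eqxx ?orbT.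
rewrite (exchange_big_dep (mem (tiling_edges T))) //=.
apply: eq_bigr => e; rewrite inE => /andP[/imsetP[[x y]]].
rewrite inE /= => xy eE /existsP[B /andP[BT eB]].
rewrite (big_pred1 B) // => B'; rewrite /= inE.
have x_e : x \in e by rewrite eE !inE eqxx.
apply/andP/eqP => [[B'T /andP[eB' _]]|->]; last first.
  by rewrite BT eB eE cards2; case: (x =P y) xy => // <-; rewrite adj_irrefl.
have xB := subsetP eB _ x_e; have xB' := subsetP eB' _ x_e.
by rewrite -(def_pblock triv BT xB) -(def_pblock triv B'T xB').
Qed.

Lemma sum_signs_eq0 (X : finType) (E F : {set X}) :
  2 * #|E :&: F| = #|E| ->
  (\sum_(e in E) (if e \in F then 1 else -1) = 0 :> int)%R.
Proof.
move=> halfE; rewrite (big_setID F) /=.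
rewrite (eq_bigr (fun=> 1%R)) => [|e /setIP[_ ->] //].
rewrite [X in (_ + X)%R](eq_bigr (fun=> (- 1)%R)); last first.
  by move=> e /setDP[_ /negbTE ->].
rewrite !GRing.sumr_const GRing.mulNrn !natz; have := cardsID F E; lia.
Qed.

(** * Copies of [K_r] against the [r+1] classes *)

Section PartiteTiling.

Variables (r : nat) (G : sgraph) (P : {set {set G}}).
Hypotheses (partP : partition P [set: G]) (cardP : #|P| = r.+1).
Hypothesis adjE : forall x y : G, adj x y = (pblock P x != pblock P y).

Let coverP (x : G) : x \in cover P.
Proof. by rewrite (cover_partition partP) inE. Qed.

Lemma clique_pblock_inj (B : {set G}) :
  clique_copy r B -> {in B &, injective (pblock P)}.
Proof.
move=> [_ cl] x y xB yB eqxy; apply/eqP; apply: contraT => /(cl _ _ xB yB).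
by rewrite adjE eqxy eqxx.
Qed.

Lemma clique_card_class (B U : {set G}) :
  clique_copy r B -> U \in P -> #|U :&: B| = (U \in pblock P @: B).
Proof.
have triv : trivIset P by case/and3P: partP.
move=> clB UP; have inj := clique_pblock_inj clB.
case: imsetP => [[x xB UE]|noU].
  apply/eqP/cards1P; exists x; apply/setP=> y; rewrite !inE.
  apply/andP/eqP => [[yU yB]|->]; last by rewrite UE mem_pblock.
  by apply: inj => //; rewrite -UE (def_pblock triv UP yU).
apply/eqP; rewrite cards_eq0 -subset0; apply/subsetP=> x /setIP[xU xB].
by case: noU; exists x; rewrite ?(def_pblock triv UP xU).
Qed.

(** The [r] vertices of [B] lie in distinct classes, so [B] misses only one of
    the [r+1] classes. *)
Lemma clique_hits_one_of_two (B U W : {set G}) :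
  clique_copy r B -> U \in P -> W \in P -> U != W ->
  (U \in pblock P @: B) || (W \in pblock P @: B).
Proof.
move=> clB UP WP UW; apply: contraT; rewrite negb_or => /andP[nU nW].
have subD : [set U; W] \subset P :\: pblock P @: B.
  by apply/subsetP=> Z; rewrite !inE => /orP[]/eqP->; rewrite ?nU ?nW.
have sub_img : pblock P @: B \subset P.
  by apply/subsetP=> _ /imsetP[x _ ->]; rewrite pblock_mem.
have := subset_leq_card subD; rewrite cards2 UW cardsD (setIidPr sub_img) cardP.
by rewrite (card_in_imset (clique_pblock_inj clB)) clB.1; lia.
Qed.

Variable T : {set {set G}}.
Hypothesis tilT : perfect_clique_tiling r T.

Lemma card_hit_class (U : {set G}) :
  U \in P -> \sum_(B in T) (U \in pblock P @: B) = #|U|.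
Proof.
have [clT triv cov] := tilT => UP.
rewrite -(sum_cardI_tiling U triv cov) //; apply: eq_bigr => B BT.
by rewrite clique_card_class //; apply: clT.
Qed.

(** Inclusion-exclusion: every copy meets [U] or [W]. *)
Lemma card_hit_pair (U W : {set G}) :
  U \in P -> W \in P -> U != W ->
  \sum_(B in T) ([set U; W] \subset pblock P @: B) + #|T| = #|U| + #|W|.
Proof.
move=> UP WP UW; rewrite -(card_hit_class UP) // -(card_hit_class WP) //.
rewrite -sum1_card -!big_split /=; apply: eq_bigr => B BT.
have clB : clique_copy r B by have [clT _ _] := tilT; apply: clT.
have := clique_hits_one_of_two clB UP WP UW.
by rewrite subUset !sub1set; do 2!case: (_ \in _).
Qed.

Lemma card_tiling_copies : #|T| * r = #|G|.
Proof.
have [clT triv cov] := tilT.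
rewrite -cardsT -(sum_cardI_tiling _ triv cov) // -sum_nat_const.
by apply: eq_bigr => B /clT[cB _]; rewrite setTI cB.
Qed.

Lemma card_tiling_edges : #|tiling_edges T| = #|T| * 'C(r, 2).
Proof.
have [clT _ _] := tilT.
rewrite -sum1_card (sum_tiling_edges _ tilT) -sum_nat_const.
by apply: eq_bigr => B /clT[cB _]; rewrite sum1_card card_pairs_in cB.
Qed.

Variables (V A : {set G}) (C : {set {set {set G}}}).
Hypotheses (VP : V \in P) (AV : A \subset V).
Hypothesis pairsC : C \subset pairs_in (P :\ V).

Definition positive_edges : {set {set G}} :=
  [set e : {set G} | (e :&: A != set0) || (pblock P @: e \in C)].

(** The two kinds of positive edges are disjoint: an edge meeting [A] has an end
    in [V], and [V] belongs to no pair of [C]. *)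
Lemma card_positive_pairs (B : {set G}) : B \in T ->
  #|pairs_in B :&: positive_edges| =
  #|A :&: B| * r.-1 + #|[set c in C | c \subset pblock P @: B]|.
Proof.
have triv : trivIset P by case/and3P: partP.
have [clT _ _] := tilT => /clT clB.
have C2 c : c \in C -> #|c| = 2.
  by move/(subsetP pairsC); rewrite inE => /andP[_ /eqP].
have AB_le1 : #|A :&: B| <= 1.
  apply: leq_trans (subset_leq_card (setSI B AV)) _.
  by rewrite clique_card_class // leq_b1.
rewrite -{1}clB.1 -(card_pairs_meeting AB_le1).
rewrite -(card_pairs_image (clique_pblock_inj clB) C2) -cardsUI.
rewrite [X in _ + #|pred_of_set X|](_ : _ = set0) ?cards0 ?addn0; last first.
  apply/setP=> e; rewrite !inE; apply/negP.
  case/andP=> /andP[_ /set0Pn[x /setIP[xe xA]]] /andP[_ /(subsetP pairsC)].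
  rewrite inE => /andP[/subsetP/(_ (pblock P x)) + _].
  rewrite imset_f // => /(_ isT).
  by rewrite (def_pblock triv VP) ?(subsetP AV) // !inE eqxx.
by apply: eq_card => e; rewrite !inE -andb_orr.
Qed.

Variable N : nat.
Hypothesis cardU : forall U : {set G}, U \in P -> #|U| = N.

Lemma card_positive_tiling_edges :
  #|tiling_edges T :&: positive_edges| =
  #|A| * r.-1 + #|C| * (2 * N - #|T|).
Proof.
have [_ triv cov] := tilT.
transitivity (\sum_(B in T) #|pairs_in B :&: positive_edges|).
  rewrite card_setId_sum (sum_tiling_edges _ tilT); apply: eq_bigr => B _.
  by rewrite card_setId_sum.
rewrite (eq_bigr _ card_positive_pairs) big_split /= -big_distrl /=.
rewrite sum_cardI_tiling //; congr (_ + _).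
transitivity (\sum_(B in T) \sum_(c in C) (c \subset pblock P @: B)).
  by apply: eq_bigr => B _; rewrite card_setId_sum.
rewrite exchange_big /= -sum_nat_const; apply: eq_bigr => c cC.
have := subsetP pairsC c cC; rewrite inE => /andP[cP /cards2P[U [W [UW cE]]]].
have inP Z : Z \in c -> Z \in P.
  by move/(subsetP cP); rewrite inE => /andP[].
have UP : U \in P by apply: inP; rewrite cE !inE eqxx.
have WP : W \in P by apply: inP; rewrite cE !inE eqxx orbT.
have := card_hit_pair UP WP UW.
by rewrite -cE !cardU // addnn -mul2n => <-; rewrite addnK.
Qed.

End PartiteTiling.

(** * The minimum degree, and the labelling *)

Lemma min_degree_regular (G : sgraph) (d : nat) :
  0 < #|G| -> (forall x : G, degree x = d) -> min_degree G = d.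
Proof.
move=> /card_gt0P[x0 _] deg.
have d_le : d <= #|G| by rewrite -(deg x0) max_card.
have bigE (s : seq G) : \big[minn/#|G|]_(x <- s) degree x =
    if nilp s then #|G| else d.
  elim: s => [|x s IHs]; first by rewrite big_nil.
  by rewrite big_cons deg IHs /=; apply/minn_idPl; case: ifP.
rewrite /min_degree bigE; have := mem_index_enum x0.
by case: index_enum.
Qed.

Lemma min_degree_partite (G : sgraph) (P : {set {set G}}) (N : nat) :
  0 < #|G| -> partition P [set: G] ->
  (forall U : {set G}, U \in P -> #|U| = N) ->
  (forall x y : G, adj x y = (pblock P x != pblock P y)) ->
  min_degree G = #|G| - N.
Proof.
move=> G_gt0 partP cardU adjE; apply: min_degree_regular => // x.
have /and3P[_ triv _] := partP.
have covP y : y \in cover P by rewrite (cover_partition partP) inE.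
rewrite -(cardU (pblock P x)) ?pblock_mem // -(cardC (mem (pblock P x))) addKn.
apply: eq_card => y; rewrite !inE adjE.
by rewrite -eq_pblock.
Qed.

Theorem proposition3p2 (m r n : nat) (G : sgraph)
    (m_gt0 : (0 < m)%N) (rE : r = (4 * m + 2)%N)
    (n_gt0 : (0 < n)%N) (dvd_n : (2 * r * r.+1 %| n)%N)
    (cardG : #|G| = n) (balG : complete_balanced_partite r.+1 G) :
  ((min_degree G)%:R = (1 - 1 / r.+1%:R) * n%:R :> rat)%R /\
  exists f : {set G} -> int,
    (forall e : {set G}, e \in edges G -> f e = (-1)%R \/ f e = 1%R) /\
    (forall T : {set {set G}}, perfect_clique_tiling r T ->
       (\sum_(e in tiling_edges T) f e = 0)%R).
Proof.
have [k nE] := dvdnP dvd_n.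
have [P [partP cardP cardU adjE]] := balG.
have {}cardU U : U \in P -> #|U| = 2 * r * k.
  by move/cardU=> ->; rewrite cardG nE mulnA mulnK // mulnC.
split.
  rewrite (min_degree_partite (P := P) (N := 2 * r * k)) ?cardG // nE.
  have -> : k * (2 * r * r.+1) - 2 * r * k = 2 * r * k * r by lia.
  have r1_neq0 : (r.+1%:R != 0 :> rat)%R by rewrite Num.Theory.pnatr_eq0.
  rewrite !GRing.natrM -[in RHS](GRing.natr1 _ r); field.
  by rewrite GRing.natr1.
have [V VP] : exists V, V \in P by apply/card_gt0P; rewrite cardP.
have [A AV cardA] : exists2 A : {set G}, A \subset V & #|A| = r.-1 * k.
  by apply: exists_subset_card; rewrite cardU // leq_mul2r; lia.
have binE : 'C(r, 2) = (2 * m + 1) * (4 * m + 1).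
  have := mul_bin_diag r 1; rewrite bin1 rE; lia.
(* The size of [C] is [('C(r, 2) + 1) / 2], expanded using [binE]. *)
have [C pairsC cardC] : exists2 C : {set {set {set G}}},
    C \subset pairs_in (P :\ V) & #|C| = 4 * m * m + 3 * m + 1.
  apply: exists_subset_card; rewrite card_pairs_in.
  have -> : #|P :\ V| = r by have := cardsD1 V P; rewrite VP cardP; lia.
  by rewrite binE; nia.
exists (fun e => if e \in positive_edges P A C then 1%R else (-1)%R).
split=> [e _|T tilT]; first by case: ifP => _; [right | left].
apply: sum_signs_eq0.
rewrite (card_positive_tiling_edges partP cardP adjE tilT VP AV pairsC cardU).
rewrite (card_tiling_edges tilT) cardA cardC binE.
have -> : #|T| = 2 * k * r.+1.
  have := card_tiling_copies tilT; rewrite cardG nE => TrE.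
  by apply/eqP; rewrite -(@eqn_pmul2r r) ?TrE; lia.
have -> : 2 * (2 * r * k) - 2 * k * r.+1 = 2 * k * r.-1 by rewrite rE; nia.
have -> : r.-1 = 4 * m + 1 by lia.
by rewrite rE; ring.
Qed.
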